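(* Let $\mathcal{A}$ and $\mathcal{B}$ be Banach algebras. Suppose $\varphi:\mathcal{A}\to\mathcal{B}$ and $\psi:\mathcal{B}\to\mathcal{A}$ are continuous homomorphisms such that $\varphi\circ\psi=I_{\mathcal{B}}$, where $I_{\mathcal{B}}$ is the identity map of $\mathcal{B}$. Then: (i) If $\mathcal{A}$ is approximately cyclic amenable, then so is $\mathcal{B}$. (ii) If $(\mathcal{A}^{**},\square)$ is approximately cyclic amenable, then so is $(\mathcal{B}^{**},\square)$.
   Context: Banach algebras are over $\mathbb{C}$ and need not be unital; homomorphisms are algebra homomorphisms. For a Banach algebra $\mathcal{A}$, the dual $\mathcal{A}^{*}$ is a Banach $\mathcal{A}$-bimodule via $\langle a\cdot x^{*},x\rangle=\langle x^{*},xa\rangle$ and $\langle x^{*}\cdot a,x\rangle=\langle x^{*},ax\rangle$ for $a,x\in\mathcal{A}$, $x^*\in\mathcal{A}^*$. A derivation $D:\mathcal{A}\to\mathcal{A}^{*}$ is a bounded linear map with $D(ab)=D(a)\cdot b+a\cdot D(b)$ for all $a,b\in\mathcal{A}$. It is cyclic if $\langle D(a),b\rangle+\langle D(b),a\rangle=0$ for all $a,b\in\mathcal{A}$. It is approximately inner if there is a net $(x_\alpha)\subseteq\mathcal{A}^{*}$ (not required to be bounded) with $D(a)=\lim_\alpha(a\cdot x_\alpha-x_\alpha\cdot a)$ in norm for every $a\in\mathcal{A}$. $\mathcal{A}$ is approximately cyclic amenable if every cyclic derivation $D:\mathcal{A}\to\mathcal{A}^{*}$ is approximately inner. The first Arens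 product $\square$ on $\mathcal{A}^{**}$ is defined by $\langle a^{*}\cdot a,b\rangle=\langle a^{*},ab\rangle$, $\langle a^{**}\cdot a^{*},a\rangle=\langle a^{**},a^{*}\cdot a\rangle$, $\langle a^{**}\square b^{**},a^{*}\rangle=\langle a^{**},b^{**}\cdot a^{*}\rangle$ for $a,b\in\mathcal{A}$, $a^*\in\mathcal{A}^*$, $a^{**},b^{**}\in\mathcal{A}^{**}$; it makes $\mathcal{A}^{**}$ a Banach algebra. *)

(* Defs.v *)
From HB Require Import structures.
From mathcomp Require Import all_boot all_order all_algebra.
From mathcomp Require Export complex.
From mathcomp Require Import boolp classical_sets functions reals.
From mathcomp Require Import filter topology normedtype.

Set Implicit Arguments.
Unset Strict Implicit.
Unset Printing Implicit Defensive.

Import Order.TTheory GRing.Theory Num.Theory.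
Import numFieldNormedType.Exports.

Local Open Scope classical_set_scope.
Local Open Scope complex_scope.
Local Open Scope ring_scope.

(* MathComp's algebra structures are all unital, hence the explicit
   multiplication [bmul]. *)
HB.mixin Record isBanachAlgebra (K : numFieldType) A
    & CompleteNormedModule K A := {
  bmul : A -> A -> A;
  bmulA : associative bmul;
  bmulDl : left_distributive bmul +%R;
  bmulDr : right_distributive bmul +%R;
  bmulZl : forall (k : K) (x y : A), bmul (k *: x) y = k *: bmul x y;
  bmulZr : forall (k : K) (x y : A), bmul x (k *: y) = k *: bmul x y;
  bmul_norm : forall x y : A, `|bmul x y| <= `|x| * `|y|;
}.

#[short(type="banachAlgType")]
HB.structure Definition BanachAlgebra (K : numFieldType) :=
  {A of isBanachAlgebra K A & CompleteNormedModule K A}.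

Definition bounded_operator (K : numFieldType) (V W : normedModType K)
    (f : V -> W) : Prop :=
  exists M : K, forall x : V, `|f x| <= M * `|x|.

Lemma Re_ge0K (R : realType) (z : R[i]) : 0 <= z -> (complex.Re z)%:C = z.
Proof. by move=> z0; apply: RRe_real; exact: ger0_real. Qed.

(* The scalars [R[i]] carry their topology and module structure through the
   regular module [R[i]^o]. *)
Section Dual.
Variables (R : realType) (V : normedModType R[i]).

Definition is_dual : {pred V -> R[i]^o} :=
  fun f => `[< linear f /\ bounded_operator f >].

Record dual : Type := Dual {
  dual_fun :> V -> R[i]^o;
  dual_funP : dual_fun \in is_dual }.

HB.instance Definition _ := [isSub for dual_fun].
HB.instance Definition _ := [Choice of dual by <:].

Lemma is_dualP (f : V -> R[i]^o) :
  reflect (linear f /\ bounded_operator f) (f \in is_dual).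
Proof. exact: asboolP. Qed.

Lemma bounded_opP (f : V -> R[i]^o) : bounded_operator f ->
  exists2 M : R, 0 <= M & forall x, `|f x| <= M%:C * `|x|.
Proof.
move=> [M fM]; exists (complex.Re `|M|).
  by rewrite -ler0c RRe_real ?ger0_real.
move=> x; rewrite Re_ge0K// -[`|x|]normr_id -normrM.
by rewrite ger0_norm// (le_trans _ (fM x)).
Qed.

Fact is_dual_submod : submod_closed is_dual.
Proof.
split.
  apply/is_dualP; split; first by move=> k u v /=; rewrite scaler0 addr0.
  by exists 0 => x; rewrite normr0 mul0r.
move=> k f g /is_dualP[fl /bounded_opP[M M0 fM]]
  /is_dualP[gl /bounded_opP[N N0 gN]].
apply/is_dualP; split.
  move=> a u v; rewrite !fctE /= fl gl !scalerDr !scalerA [k * a]mulrC.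
  rewrite !addrA; congr (_ + _).
  by rewrite -!addrA; congr (_ + _); rewrite addrC.
exists (`|k| * M%:C + N%:C) => x; rewrite !fctE /= (le_trans (ler_normD _ _))//.
by rewrite mulrDl lerD// normrZ -mulrA ler_wpM2l.
Qed.

HB.instance Definition _ :=
  GRing.isSubmodClosed.Build R[i] _ is_dual is_dual_submod.
HB.instance Definition _ := [SubChoice_isSubLmodule of dual by <:].

Lemma dual_linear (f : dual) : linear f.
Proof. by have /is_dualP[] := dual_funP f. Qed.

HB.instance Definition _ (f : dual) :=
  GRing.isLinear.Build R[i] V R[i]^o *:%R f (dual_linear f).

Lemma dual_bounded (f : dual) : bounded_operator f.
Proof. by have /is_dualP[] := dual_funP f. Qed.

Lemma dualP (f g : dual) : f =1 g -> f = g.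
Proof. by move=> fg; apply/val_inj/funext. Qed.

Lemma dualDE (f g : dual) x : (f + g) x = f x + g x. Proof. by []. Qed.
Lemma dualZE (k : R[i]) (f : dual) x : (k *: f) x = k *: f x. Proof. by []. Qed.
Lemma dualNE (f : dual) x : (- f) x = - f x. Proof. by []. Qed.
Lemma dual0E x : (0 : dual) x = 0. Proof. by []. Qed.

(* [`|f x|] lies in [R[i]] and is real, [Re] casts it to [R] *)
Definition dual_rnorm (f : dual) : R :=
  sup [set complex.Re `|f x| | x in [set x : V | `|x| <= 1]].

Definition dual_norm (f : dual) : R[i] := (dual_rnorm f)%:C.

Lemma dual_rnorm_has_sup (f : dual) :
  has_sup [set complex.Re `|f x| | x in [set x : V | `|x| <= 1]].
Proof.
split; first by exists (complex.Re `|f 0|), 0 => //=; rewrite normr0 ler01.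
have /bounded_opP[M M0 fM] := dual_bounded f.
exists M => _ [x x1 <-]; rewrite -lecR Re_ge0K//.
by rewrite (le_trans (fM x))// ler_piMr// ler0c.
Qed.

Lemma dual_norm_ge0 f : 0 <= dual_norm f.
Proof.
rewrite ler0c; apply: sup_upper_bound; first exact: dual_rnorm_has_sup.
exists 0; first by rewrite /= normr0 ler01.
by rewrite linear0 normr0.
Qed.

Lemma dual_normP (f : dual) x : `|f x| <= dual_norm f * `|x|.
Proof.
have [->|x0] := eqVneq x 0; first by rewrite linear0 !normr0 mulr0.
have nx0 : 0 < `|x| by rewrite normr_gt0.
rewrite -ler_pdivrMr// mulrC -[X in X * _]ger0_norm ?invr_ge0//.
rewrite -normrZ -linearZ_LR -[leLHS]Re_ge0K// lecR.
apply: sup_upper_bound; first exact: dual_rnorm_has_sup.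
exists (`|x|^-1 *: x) => //=.
by rewrite normrZ ger0_norm ?invr_ge0// mulVf ?gt_eqF.
Qed.

Lemma dual_norm_le (f : dual) (M : R[i]) : 0 <= M ->
  (forall x, `|f x| <= M * `|x|) -> dual_norm f <= M.
Proof.
move=> M0 fM; rewrite -[leRHS]Re_ge0K// lecR.
apply: ge_sup; first by have [] := dual_rnorm_has_sup f.
move=> _ [x x1 <-]; rewrite -lecR !Re_ge0K//.
by rewrite (le_trans (fM x))// ler_piMr.
Qed.

Fact dual_ler_normD f g : dual_norm (f + g) <= dual_norm f + dual_norm g.
Proof.
apply: dual_norm_le => [|x]; first by rewrite addr_ge0// dual_norm_ge0.
by rewrite dualDE (le_trans (ler_normD _ _))// mulrDl lerD// dual_normP.
Qed.

Fact dual_normrZ (k : R[i]) f : dual_norm (k *: f) = `|k| * dual_norm f.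
Proof.
have le_normZ l g : dual_norm (l *: g) <= `|l| * dual_norm g.
  apply: dual_norm_le => [|x]; first by rewrite mulr_ge0// dual_norm_ge0.
  by rewrite dualZE normrZ -mulrA ler_wpM2l// dual_normP.
have [->|k0] := eqVneq k 0.
  by apply/le_anti; rewrite le_normZ normr0 mul0r dual_norm_ge0.
apply/le_anti; rewrite le_normZ/= -ler_pdivlMl ?normr_gt0//.
by rewrite -normfV -[in leLHS](scalerK k0 f) le_normZ.
Qed.

Fact dual_normr0_eq0 f : dual_norm f = 0 -> f = 0.
Proof.
move=> f0; apply: dualP => x; apply/normr0_eq0/le_anti.
by rewrite normr_ge0 andbT (le_trans (dual_normP _ _))// f0 mul0r.
Qed.

HB.instance Definition _ := @Lmodule_isNormed.Build R[i] dual
  dual_norm dual_ler_normD dual_normrZ dual_normr0_eq0.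

Lemma dual_normE (f : dual) : `|f| = dual_norm f. Proof. by []. Qed.

End Dual.

Lemma norm_ge_Re (R : rcfType) (z : R[i]) : `|complex.Re z|%:C <= `|z|.
Proof. exact: normc_ge_Re. Qed.

Lemma norm_i (R : rcfType) : `|'i%C : R[i]| = 1.
Proof. by rewrite normc_def/= expr0n expr1n add0r sqrtr1. Qed.

Lemma norm_ge_Im (R : rcfType) (z : R[i]) : `|complex.Im z|%:C <= `|z|.
Proof.
rewrite -normrN -[- complex.Im z]ReiNIm (le_trans (norm_ge_Re _))//.
by rewrite normrM norm_i mulr1.
Qed.

Lemma normcR (R : rcfType) (x : R) : `|x%:C| = `|x|%:C.
Proof. by rewrite normc_def /= expr0n addr0 sqrtr_sqr. Qed.

Lemma norm_le_ReIm (R : rcfType) (z : R[i]) :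
  `|z| <= (`|complex.Re z| + `|complex.Im z|)%:C.
Proof.
rewrite {1}[z]complexE (le_trans (ler_normD _ _))//.
by rewrite normrM norm_i mul1r !normcR rmorphD.
Qed.

Fact complex_complete (R : realType) (F : set_system R[i]^o) :
  ProperFilter F -> cauchy F -> cvg F.
Proof.
move=> FF /cauchyP Fc; apply/cvg_ex.
have cvgh (h : R[i]^o -> R) : {morph h : x y / x - y} ->
    (forall x, `|h x|%:C <= `|x|) -> cvg (h @ F).
  move=> hB hh; apply: cauchy_cvg; apply: cauchy_exP => e e0.
  have /Fc[z Fz] : 0 < e%:C by rewrite ltcR.
  exists (h z); rewrite /= nbhs_simpl; apply: filterS Fz => x.
  by rewrite -!ball_normE /= -hB -ltcR; exact: le_lt_trans (hh _).
have /cvg_ex[a Fa] : cvg ((@complex.Re R : R[i]^o -> R) @ F).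
  by apply: cvgh; [case=> ? ? [] | exact: norm_ge_Re].
have /cvg_ex[b Fb] : cvg ((@complex.Im R : R[i]^o -> R) @ F).
  by apply: cvgh; [case=> ? ? [] | exact: norm_ge_Im].
exists (a +i* b)%C; apply/cvgrPdist_lt => e e0.
have eR : (complex.Re e)%:C = e by rewrite Re_ge0K// ltW.
have e20 : 0 < complex.Re e / 2 by rewrite divr_gt0// -ltcR eR.
near=> z; rewrite (le_lt_trans (norm_le_ReIm _))// -eR ltcR.
have za : `|a - complex.Re z| < complex.Re e / 2.
  by near: z; exact: (cvgrPdist_lt _ _).1 Fa _ e20.
have zb : `|b - complex.Im z| < complex.Re e / 2.
  by near: z; exact: (cvgrPdist_lt _ _).1 Fb _ e20.
rewrite [ltRHS]splitr.
have -> : complex.Re ((a +i* b)%C - z) = a - complex.Re z by case: (z).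
have -> : complex.Im ((a +i* b)%C - z) = b - complex.Im z by case: (z).
exact: ltrD.
Unshelve. all: by end_near. Qed.

Section DualComplete.
Variables (R : realType) (V : normedModType R[i]).

Lemma dual_normr (f : dual V) x : `|f x| <= `|f| * `|x|.
Proof. exact: dual_normP. Qed.

Lemma dual_le_normr (f : dual V) (M : R[i]) : 0 <= M ->
  (forall x, `|f x| <= M * `|x|) -> `|f| <= M.
Proof. exact: dual_norm_le. Qed.

Fact dual_complete (F : set_system (dual V)) :
  ProperFilter F -> cauchy F -> cvg F.
Proof.
move=> FF /cauchyP Fc.
have cvgx x : cvg ((fun f : dual V => f x) @ F).
  apply: complex_complete; apply: cauchy_exP => e e0.
  have x0 : 0 < `|x| + 1 by rewrite ltr_wpDl.
  have /Fc[g Fg] : 0 < e / (`|x| + 1) by rewrite divr_gt0.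
  exists (g x); rewrite /= nbhs_simpl; apply: filterS Fg => f.
  rewrite -!ball_normE /= => gf.
  rewrite (le_lt_trans (dual_normr (g - f) x))//.
  rewrite (@le_lt_trans _ _ (`|g - f| * (`|x| + 1)))//.
    by rewrite ler_wpM2l// lerDl.
  by rewrite -ltr_pdivlMr.
pose l x : R[i]^o := lim ((fun f : dual V => f x) @ F).
have Fl x : (fun f : dual V => f x) @ F --> l x by exact: cvgx.
have close (e : R[i]) : 0 < e ->
    F [set f : dual V | forall x, `|l x - f x| <= e * `|x|].
  move=> e0; have /Fc[g Fg] : 0 < e / 2 by rewrite divr_gt0.
  rewrite -ball_normE in Fg; apply: (filterS _ (Fg)) => f /= gf x.
  have gl : `|l x - g x| <= e / 2 * `|x|.
    apply/ler_addgt0Pl => d d0; near F => h.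
    rewrite -[l x](subrK (h x)) -addrA (le_trans (ler_normD _ _))// lerD//.
      by near: h; apply: (cvgrPdist_le _ _).1 (Fl x) _ d0.
    rewrite -normrN opprB (le_trans (dual_normr (g - h) x))// ler_wpM2r//.
    by apply: ltW; near: h; exact: Fg.
  rewrite -[l x](subrK (g x)) -addrA (le_trans (ler_normD _ _))//.
  rewrite [in leRHS](splitr e) mulrDl lerD//.
  by rewrite (le_trans (dual_normr (g - f) x))// ler_wpM2r// ltW.
have l_lin : linear l.
  move=> k u v.
  have H1 := @cvgZl_tmp _ _ _ F FF k (fun f => f u) _ (Fl u).
  have H2 := cvgD H1 (Fl v).
  apply: (@cvg_lim R[i]^o); first exact: norm_hausdorff.
  move=> A /H2; rewrite /= !nbhs_simpl /=; apply: filterS => f /=.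
  by rewrite dual_linear.
have l_bnd : bounded_operator l.
  near F => f; exists (1 + `|f|) => x.
  rewrite -[l x](subrK (f x)) (le_trans (ler_normD _ _))// mulrDl lerD//.
    by move: x; near: f; exact: close.
  exact: dual_normr.
have lP : l \in @is_dual R V by exact/is_dualP.
apply/cvg_ex; exists (Dual lP); apply/cvgrPdist_le => e e0.
near=> f; apply: dual_le_normr; first exact: ltW.
by near: f; exact: close.
Unshelve. all: by end_near. Qed.

HB.instance Definition _ := Uniform_isComplete.Build (dual V) dual_complete.

End DualComplete.


Lemma is_dualI (R : realType) (V : normedModType R[i])
    (h : V -> R[i]^o) (M : R[i]) :
  linear h -> (forall x, `|h x| <= M * `|x|) -> h \in @is_dual R V.
Proof. by move=> hl hM; apply/is_dualP; split=> //; exists M. Qed.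

Section DualBimodule.
Variables (R : realType) (A : banachAlgType R[i]).
Implicit Types (a b x : A) (f g : dual A).

Fact lact_subproof a f : (fun x => f (bmul x a)) \in @is_dual R A.
Proof.
apply: (is_dualI (M := `|f| * `|a|)) => [k x y|x].
  by rewrite bmulDl bmulZl dual_linear.
by rewrite (le_trans (dual_normr _ _))// -mulrA ler_wpM2l// mulrC bmul_norm.
Qed.

(* <a . x*, x> = <x*, x a> *)
Definition lact a f : dual A := Dual (lact_subproof a f).

Fact ract_subproof f a : (fun x => f (bmul a x)) \in @is_dual R A.
Proof.
apply: (is_dualI (M := `|f| * `|a|)) => [k x y|x].
  by rewrite bmulDr bmulZr dual_linear.
by rewrite (le_trans (dual_normr _ _))// -mulrA ler_wpM2l// bmul_norm.
Qed.

(* <x* . a, x> = <x*, a x> *)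
Definition ract f a : dual A := Dual (ract_subproof f a).

Lemma ract_norm f a : `|ract f a| <= `|f| * `|a|.
Proof.
apply: dual_le_normr => [|x]; first by rewrite mulr_ge0.
by rewrite (le_trans (dual_normr f _))// -mulrA ler_wpM2l// bmul_norm.
Qed.

Fact bidual_act_subproof (F : dual (dual A)) f :
  (fun a => F (ract f a)) \in @is_dual R A.
Proof.
apply: (is_dualI (M := `|F| * `|f|)) => [k x y|x].
  rewrite -dual_linear; congr (F _); apply: dualP => z.
  by rewrite dualDE dualZE /= bmulDl bmulZl dual_linear.
by rewrite (le_trans (dual_normr _ _))// -mulrA ler_wpM2l// ract_norm.
Qed.

(* <a** . a*, a> = <a**, a* . a> *)
Definition bidual_act (F : dual (dual A)) f : dual A :=
  Dual (bidual_act_subproof F f).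

Lemma bidual_act_norm F f : `|bidual_act F f| <= `|F| * `|f|.
Proof.
apply: dual_le_normr => [|x]; first by rewrite mulr_ge0.
by rewrite (le_trans (dual_normr F _))// -mulrA ler_wpM2l// ract_norm.
Qed.

Fact arens_subproof (F G : dual (dual A)) :
  (fun f => F (bidual_act G f)) \in @is_dual R (dual A).
Proof.
apply: (is_dualI (M := `|F| * `|G|)) => [k f g|f].
  rewrite -dual_linear; congr (F _); apply: dualP => z.
  rewrite dualDE dualZE /= -dual_linear; congr (G _).
  by apply: dualP => x; rewrite dualDE dualZE.
by rewrite (le_trans (dual_normr _ _))// -mulrA ler_wpM2l// bidual_act_norm.
Qed.

(* <a** [] b**, a*> = <a**, b** . a*> *)
Definition arens (F G : dual (dual A)) : dual (dual A) :=
  Dual (arens_subproof F G).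

Fact arensA : associative arens.
Proof.
move=> F G H; apply: dualP => f /=; congr (F _); apply: dualP => a /=.
congr (G _); apply: dualP => b /=; congr (H _); apply: dualP => x /=.
by rewrite bmulA.
Qed.

Fact arensDl : left_distributive arens +%R.
Proof. by move=> F G H; apply: dualP => f. Qed.

Fact arensDr : right_distributive arens +%R.
Proof.
move=> F G H; apply: dualP => f; rewrite dualDE /= -raddfD.
by congr (F _); apply: dualP.
Qed.

Fact arensZl (k : R[i]) F G : arens (k *: F) G = k *: arens F G.
Proof. exact: dualP. Qed.

Fact arensZr (k : R[i]) F G : arens F (k *: G) = k *: arens F G.
Proof.
apply: dualP => f; rewrite dualZE /= -linearZ_LR.
by congr (F _); apply: dualP.
Qed.

Fact arens_norm F G : `|arens F G| <= `|F| * `|G|.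
Proof.
apply: dual_le_normr => [|x]; first by rewrite mulr_ge0.
by rewrite (le_trans (dual_normr F _))// -mulrA ler_wpM2l// bidual_act_norm.
Qed.

End DualBimodule.

(* The second dual as a Banach algebra under the first Arens product; the
   alias keeps [dual (dual A)] itself without a multiplication. *)
Definition bidual (R : realType) (A : banachAlgType R[i]) : Type :=
  dual (dual A).

HB.instance Definition _ (R : realType) (A : banachAlgType R[i]) :=
  CompleteNormedModule.copy (bidual A) (dual (dual A)).
HB.instance Definition _ (R : realType) (A : banachAlgType R[i]) :=
  isBanachAlgebra.Build R[i] (bidual A) (@arensA R A) (@arensDl R A)
    (@arensDr R A) (@arensZl R A) (@arensZr R A) (@arens_norm R A).

Record directed (I : Type) (le : I -> I -> Prop) : Prop := Directed {
  directed_inhabited : inhabited I;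
  directed_refl : forall i, le i i;
  directed_trans : forall i j k, le i j -> le j k -> le i k;
  directed_ub : forall i j, exists k, le i k /\ le j k }.

(* [f @ net_filter le --> l] is convergence of the net [f : I -> _] *)
Definition net_filter (I : Type) (le : I -> I -> Prop) : set_system I :=
  filter_from setT (fun i0 => [set i | le i0 i]).

Section CyclicAmenability.
Variables (R : realType) (A : banachAlgType R[i]).

Definition is_derivation (D : {linear A -> dual A}) : Prop :=
  bounded_operator D /\
  forall a b, D (bmul a b) = ract (D a) b + lact a (D b).

Definition is_cyclic (D : A -> dual A) : Prop :=
  forall a b, D a b + D b a = 0.

Definition approximately_inner (D : A -> dual A) : Prop :=
  exists (I : Type) (le : I -> I -> Prop) (x : I -> dual A),
    directed le /\
    forall a, (fun i => lact a (x i) - ract (x i) a) @ net_filter le --> D a.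

Definition approximately_cyclic_amenable : Prop :=
  forall D : {linear A -> dual A},
    is_derivation D -> is_cyclic D -> approximately_inner D.

End CyclicAmenability.

(* Main.v *)
From HB Require Import structures.
Require Import Defs.
From mathcomp Require Import all_boot all_order all_algebra.
From mathcomp Require Import complex.
From mathcomp Require Import boolp reals filter topology normedtype.

(** Cyclic amenability passes to retracts because both the derivation and the
    net implementing it can be moved along adjoints.  Given a cyclic derivation
    [D] on [B], the map [D' = phi^* \o D \o phi] is a derivation on [A], since
    [phi^*] intertwines the module actions of [B^*] and [A^*] over [phi], and it
    is cyclic because [D' a] at [b] is [D (phi a)] at [phi b].  If the
    net [x] in [A^*] implements [D'], then [psi^* x] implements [D]: indeed
    [psi^*] carries [psi b . x - x . psi b] to [b . psi^* x - psi^* x . b],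
    it is continuous, and it carries [D' (psi b)] to [D b] because
    [(phi \o psi)^*] is the identity.

    This argument ([retract_approximately_cyclic_amenable]) applies to any pair
    of bounded homomorphisms with [phi \o psi = id].  For the second duals the
    pair [phi^**], [psi^**] qualifies: second adjoints of bounded homomorphisms
    are bounded, are multiplicative for the first Arens product ([bidual_mapM]),
    and depend functorially on the homomorphism. *)

Set Implicit Arguments.
Unset Strict Implicit.
Unset Printing Implicit Defensive.

Import Order.TTheory GRing.Theory Num.Theory.
Import numFieldNormedType.Exports.
Local Open Scope classical_set_scope.
Local Open Scope ring_scope.

Lemma bounded_operator_ge0 (K : numFieldType) (V W : normedModType K)
    (f : V -> W) :
  bounded_operator f -> exists2 M : K, 0 <= M & forall x, `|f x| <= M * `|x|.
Proof.
move=> [M fM]; exists `|M| => // x.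
by rewrite -[`|x|]normr_id -normrM ger0_norm// (le_trans _ (fM x)).
Qed.

Lemma bounded_operator_comp (K : numFieldType) (U V W : normedModType K)
    (f : V -> W) (g : U -> V) :
  bounded_operator f -> bounded_operator g -> bounded_operator (f \o g).
Proof.
move=> /bounded_operator_ge0[M M0 fM] [N gN]; exists (M * N) => x /=.
by rewrite (le_trans (fM _))// -mulrA ler_wpM2l.
Qed.

Lemma continuous_bounded_operator (K : numFieldType) (V W : normedModType K)
    (f : {linear V -> W}) : continuous f -> bounded_operator f.
Proof.
move=> fc; have /linear_boundedP/pinfty_ex_gt0[M M0 fM] : bounded_near f (nbhs 0).
  exact/linear_bounded_continuous.
by exists M.
Qed.

Lemma bounded_operator_continuous (K : numFieldType) (V W : normedModType K)
    (f : {linear V -> W}) : bounded_operator f -> continuous f.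
Proof.
move=> /bounded_operator_ge0[M M0 fM]; apply/linear_bounded_continuous.
apply/linear_boundedP; exists M; split; first exact: ger0_real.
by move=> N /ltW MN x; rewrite (le_trans (fM x))// ler_wpM2r.
Qed.

(** * Adjoints of bounded operators *)

Section DualMap.
Variables (R : realType) (V W : normedModType R[i]).
Variables (f : {linear V -> W}) (fb : bounded_operator f).

Fact dual_map_subproof (g : dual W) : (g \o f) \in @is_dual R V.
Proof.
apply/is_dualP; split; first by move=> k x y /=; rewrite !linearP.
by apply: bounded_operator_comp => //; exact: dual_bounded.
Qed.

(** The boundedness proof is an argument so that the adjoint is a total
    function carrying a canonical linear structure. *)
Definition dual_map (g : dual W) : dual V := Dual (dual_map_subproof g).

Fact dual_map_linear : linear dual_map.
Proof. by move=> k g h; exact: dualP. Qed.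

HB.instance Definition _ :=
  GRing.isLinear.Build R[i] (dual W) (dual V) *:%R dual_map dual_map_linear.

Lemma dual_map_bounded : bounded_operator dual_map.
Proof.
have [M M0 fM] := bounded_operator_ge0 fb; exists M => g.
apply: dual_le_normr => [|x]; first by rewrite mulr_ge0.
by rewrite (le_trans (dual_normr g _))// [M * _]mulrC -mulrA ler_wpM2l.
Qed.

End DualMap.

(** * Adjoints of homomorphisms and the module actions *)

Section DualMapMorphism.
Variables (R : realType) (A B : banachAlgType R[i]).
Variables (f : {linear A -> B}) (fb : bounded_operator f).
Hypothesis fM : {morph f : x y / bmul x y}.

Lemma dual_map_lact a g : dual_map fb (lact (f a) g) = lact a (dual_map fb g).
Proof. by apply: dualP => x /=; rewrite fM. Qed.

Lemma dual_map_ract g a : dual_map fb (ract g (f a)) = ract (dual_map fb g) a.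
Proof. by apply: dualP => x /=; rewrite fM. Qed.

(** The source and target are retyped as [bidual] so that they carry the Arens
    product. *)
Definition bidual_map : {linear bidual A -> bidual B} :=
  dual_map (dual_map_bounded fb).

Lemma bidual_map_bounded : bounded_operator bidual_map.
Proof. exact: dual_map_bounded. Qed.

Lemma dual_map_bidual_act G g :
  dual_map fb (bidual_act (bidual_map G) g) = bidual_act G (dual_map fb g).
Proof. by apply: dualP => a /=; rewrite dual_map_ract. Qed.

(** Both sides evaluate [F] at a functional on [A], and these agree since the
    action of [A^**] on [A^*] is natural in the homomorphism. *)
Lemma bidual_mapM : {morph bidual_map : F G / bmul F G}.
Proof.
move=> F G; apply: dualP => g.
by congr (dual_fun F _); rewrite -dual_map_bidual_act.
Qed.

End DualMapMorphism.

(** * Retracts *)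

Section Retract.
Variables (R : realType) (A B : banachAlgType R[i]).
Variables (phi : {linear A -> B}) (psi : {linear B -> A}).
Hypothesis phiM : {morph phi : x y / bmul x y}.
Hypothesis psiM : {morph psi : x y / bmul x y}.
Hypotheses (phib : bounded_operator phi) (psib : bounded_operator psi).

(** The adjoint [phi^*] is a module map over [phi], which turns the two terms
    of the Leibniz rule over [B] into those over [A]. *)
Lemma dual_map_derivation (D : {linear B -> dual B}) :
  is_derivation D -> is_derivation (dual_map phib \o D \o phi).
Proof.
move=> [Db DM]; split.
  apply: bounded_operator_comp => //; apply: bounded_operator_comp => //.
  exact: dual_map_bounded.
move=> a b /=; rewrite phiM DM linearD.
by congr (_ + _); [exact: dual_map_ract | exact: dual_map_lact].
Qed.

Lemma dual_map_cyclic (D : B -> dual B) :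
  is_cyclic D -> is_cyclic (dual_map phib \o D \o phi).
Proof. by move=> Dc a b; exact: Dc. Qed.

(** The adjoint [psi^*] sends the inner derivation of [A] given by [x],
    restricted along [psi], to the inner derivation of [B] given by [psi^* x],
    and boundedness of [psi^*] lets it pass to the limit of the net. *)
Lemma dual_map_approximately_inner (D : A -> dual A) :
  approximately_inner D -> approximately_inner (dual_map psib \o D \o psi).
Proof.
move=> [I [le [x [le_dir Dx]]]]; exists I, le, (dual_map psib \o x).
split=> // b; have psi_cvg := bounded_operator_continuous (dual_map_bounded psib).
have act_psi : (fun i => lact b ((dual_map psib \o x) i) -
    ract ((dual_map psib \o x) i) b) =
    dual_map psib \o (fun i => lact (psi b) (x i) - ract (x i) (psi b)).
  apply: funext => i /=; rewrite linearB.
  by congr (_ - _); [rewrite -dual_map_lact | rewrite -dual_map_ract].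
rewrite act_psi; exact: cvg_comp (Dx (psi b)) (psi_cvg (D (psi b))).
Qed.

Theorem retract_approximately_cyclic_amenable :
  phi \o psi =1 id ->
  approximately_cyclic_amenable A -> approximately_cyclic_amenable B.
Proof.
move=> phipsi Aca D Dder Dcyc.
have /dual_map_approximately_inner :=
  Aca _ (dual_map_derivation Dder) (dual_map_cyclic Dcyc).
congr approximately_inner; apply: funext => b; apply: dualP => c /=.
by rewrite (phipsi b : phi (psi b) = b) (phipsi c : phi (psi c) = c).
Qed.

Lemma bidual_map_retract :
  phi \o psi =1 id -> bidual_map phib \o bidual_map psib =1 id.
Proof.
move=> phipsi F; apply: dualP => g /=; congr (dual_fun F _).
by apply: dualP => b /=; rewrite (phipsi b : phi (psi b) = b).
Qed.

End Retract.

Theorem theorem3p3 (R : realType) (A B : banachAlgType R[i])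
    (phi : {linear A -> B}) (psi : {linear B -> A})
    (phi_mul : {morph phi : x y / bmul x y})
    (psi_mul : {morph psi : x y / bmul x y})
    (phi_cont : continuous phi) (psi_cont : continuous psi)
    (phipsi : phi \o psi =1 id) :
  (approximately_cyclic_amenable A -> approximately_cyclic_amenable B) /\
  (approximately_cyclic_amenable (bidual A) ->
   approximately_cyclic_amenable (bidual B)).
Proof.
have phib := continuous_bounded_operator phi_cont.
have psib := continuous_bounded_operator psi_cont.
split; first exact: retract_approximately_cyclic_amenable phipsi.
apply: (retract_approximately_cyclic_amenable
  (phi := bidual_map phib) (psi := bidual_map psib)).
- exact: bidual_mapM.
- exact: bidual_mapM.
- exact: bidual_map_bounded.
- exact: bidual_map_bounded.
- exact: bidual_map_retract.
Qed.
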